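(* Let $n \ge 10$ be an integer. There exists an $n$-unexceptional $2$-connected graph $G$ of order $n$ such that $\eta(G) = 2n$.
   Context: All graphs are finite, simple and connected; the order of a graph is its number of vertices. Let $d_G(u,v)$ be the usual shortest-path distance. The Wiener index is $W(G)=\sum_{\{u,v\}\subseteq V(G)} d_G(u,v)$, the sum being over unordered pairs of distinct vertices. For an edge $ab\in E(G)$ let $n_{ab}(a)=|\{c\in V(G): d_G(c,a)<d_G(c,b)\}|$ and $n_{ab}(b)=|\{c\in V(G): d_G(c,b)<d_G(c,a)\}|$. The Szeged index is $Sz(G)=\sum_{ab\in E(G)} n_{ab}(a)\,n_{ab}(b)$. The Szeged--Wiener gap is $\eta(G)=Sz(G)-W(G)$. For integers $n,t$ with $1\le t\le n-1$, $K_n^t$ denotes the graph of order $n$ obtained from the complete graph $K_{n-1}$ by adding one new vertex adjacent to exactly $t$ vertices of $K_{n-1}$. A graph $G$ is $n$-exceptional if it is isomorphic to one of $K_n$, $K_n^2$, $K_n^{n-2}$, and $n$-unexceptional otherwise. *)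

(* Defs.v *)
From mathcomp Require Import all_boot all_order all_algebra.

Set Implicit Arguments.
Unset Strict Implicit.
Unset Printing Implicit Defensive.

Record sgraph := SGraph {
  vertex :> finType;
  edge : rel vertex;
  edge_sym : symmetric edge;
  edge_irrefl : irreflexive edge
}.

Definition graph_iso (G H : sgraph) : Prop :=
  exists2 f : G -> H, bijective f & forall x y, edge (f x) (f y) = edge x y.

Definition connected (G : sgraph) : Prop :=
  0 < #|G| /\ forall x y : G, connect (@edge G) x y.

Section DeleteVertex.
Variables (G : sgraph) (v : G).

Definition del_edge : rel {x : G | x != v} := fun x y => edge (val x) (val y).

Lemma del_edge_sym : symmetric del_edge.
Proof. by move=> x y; apply: edge_sym. Qed.

Lemma del_edge_irrefl : irreflexive del_edge.
Proof. by move=> x; apply: edge_irrefl. Qed.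

Definition del_vertex : sgraph := SGraph del_edge_sym del_edge_irrefl.

End DeleteVertex.

Definition two_connected (G : sgraph) : Prop :=
  [/\ 2 < #|G|, connected G & forall v : G, connected (del_vertex v)].

Section Indices.
Variable G : sgraph.
Implicit Types u v a b : G.

Definition has_walk u v (k : nat) : bool :=
  [exists p : k.-tuple G, path (@edge G) u p && (last u p == v)].

(* The least length of a walk from u to v; the junk value #|G| is returned
   exactly when v is not reachable from u, see distP and dist_disconnected. *)
Definition dist u v : nat := find (has_walk u v) (iota 0 #|G|).

(* Each unordered pair {u, v} of distinct vertices is counted once, through its
   orientation with enum_rank u < enum_rank v. The same device is used for
   edges; in both sums the summand is symmetric in its two vertices. *)
Definition wiener : nat :=
  \sum_(u : G) \sum_(v : G | enum_rank u < enum_rank v) dist u v.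

Definition closer a b : nat := #|[set c : G | dist c a < dist c b]|.

Definition szeged : nat :=
  \sum_(a : G) \sum_(b : G | (enum_rank a < enum_rank b) && edge a b)
    closer a b * closer b a.

Definition gap : int := (szeged%:Z - wiener%:Z)%R.

Lemma has_walkP u v k :
  reflect (exists p, [/\ path (@edge G) u p, last u p = v & size p = k])
          (has_walk u v k).
Proof.
apply: (iffP existsP) => [[p /andP[pp /eqP lp]]|[p [pp lp sp]]].
  by exists p; rewrite size_tuple.
have sp' : size p == k by apply/eqP.
by exists (Tuple sp'); rewrite /= pp lp eqxx.
Qed.

Lemma distP u v : connect (@edge G) u v ->
  has_walk u v (dist u v) /\ forall k, has_walk u v k -> dist u v <= k.
Proof.
case/connectP=> p pp ->; case/shortenP: pp => q pq uq _.
have sq : size q < #|G| by rewrite -[(size q).+1]/(size (u :: q)) -(card_uniqP uq) max_card.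
have wq : has (has_walk u (last u q)) (iota 0 #|G|).
  apply/hasP; exists (size q); first by rewrite mem_iota.
  by apply/has_walkP; exists q.
split.
  have := nth_find 0 wq; rewrite nth_iota ?add0n //.
  by rewrite -{2}[#|G|](size_iota 0) -has_find.
move=> k wk; rewrite leqNgt; apply/negP=> lt_k.
have := before_find 0 lt_k; rewrite nth_iota ?add0n ?wk //.
by apply: leq_trans lt_k _; rewrite -[X in _ <= X](size_iota 0) find_size.
Qed.

Lemma dist_disconnected u v : ~~ connect (@edge G) u v -> dist u v = #|G|.
Proof.
move=> nuv; rewrite /dist hasNfind ?size_iota //.
apply: contra nuv => /hasP[k _ /has_walkP[p [pp lp _]]].
by apply/connectP; exists p.
Qed.

End Indices.

Definition complete_graph (n : nat) : sgraph :=
  @SGraph 'I_n (fun x y => x != y)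
    (fun x y => congr1 negb (eq_sym x y)) (fun x => congr1 negb (eqxx x)).

Section CompletePlusVertex.
Variables n t : nat.

(* Some i ranges over the vertices of the complete graph on n - 1 vertices,
   and None is the added vertex, adjacent to the t vertices Some i with i < t. *)
Definition Knt_edge : rel (option 'I_n.-1) := fun x y =>
  match x, y with
  | Some i, Some j => i != j
  | Some i, None | None, Some i => i < t
  | None, None => false
  end.

Lemma Knt_edge_sym : symmetric Knt_edge.
Proof. by case=> [i|] [j|] //=; rewrite eq_sym. Qed.

Lemma Knt_edge_irrefl : irreflexive Knt_edge.
Proof. by case=> [i|] //=; rewrite eqxx. Qed.

(* Meaningful for 1 <= t <= n - 1. *)
Definition Knt : sgraph := SGraph Knt_edge_sym Knt_edge_irrefl.

End CompletePlusVertex.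

Definition exceptional (n : nat) (G : sgraph) : Prop :=
  [\/ graph_iso G (complete_graph n), graph_iso G (Knt n 2)
    | graph_iso G (Knt n (n - 2))].

(* Main.v *)
Require Import Defs.
From mathcomp Require Import all_boot all_order all_algebra.
From mathcomp Require Import zify.

Set Implicit Arguments.
Unset Strict Implicit.
Unset Printing Implicit Defensive.

(** The witness is the clique K_(n-2) with a 4-cycle glued along one of its
    edges: writing k = n - 4, the Wiener index is 8 + 6 k + 'C(k, 2) and the
    Szeged index is 16 + 8 k + 'C(k, 2). It is unexceptional because the two
    diagonals of the 4-cycle are disjoint non-edges, whereas in K_n^t all
    non-edges share the added vertex. *)

(** * Recognising the distance as a potential function *)

Section Distance.
Variables (G : sgraph) (f : G -> G -> nat).
Hypothesis f_refl : forall v, f v v = 0.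
Hypothesis f_lip : forall x y v, edge x y -> f x v <= (f y v).+1.
Hypothesis f_desc :
  forall x v, x != v -> exists2 y, edge x y & f x v = (f y v).+1.

Lemma potential_le_walk x v p :
  path (@edge G) x p -> last x p = v -> f x v <= size p.
Proof.
elim: p x => [|y p IHp] x /=; first by move=> _ ->; rewrite f_refl.
by case/andP=> exy pp lp; apply: leq_trans (f_lip _ exy) _; apply: IHp.
Qed.

Lemma potential_walk x v : has_walk x v (f x v).
Proof.
move Dm: (f x v) => m; elim: m x Dm => [|m IHm] x Dm.
  have [-> | /f_desc[y _]] := eqVneq x v; last by rewrite Dm.
  by apply/has_walkP; exists [::].
have [eq_xv | /f_desc[y exy]] := eqVneq x v; first by rewrite eq_xv f_refl in Dm.
rewrite Dm => -[Dy]; case/has_walkP: (IHm y (esym Dy)) => p [pp lp sp].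
by apply/has_walkP; exists (y :: p); rewrite /= exy pp sp.
Qed.

Lemma potential_connect x v : connect (@edge G) x v.
Proof.
by case/has_walkP: (potential_walk x v) => p [pp lp _]; apply/connectP; exists p.
Qed.

(** Since [f] drops by at most one along an edge, [f x v] bounds every walk length from below;
    descending greedily to [v] gives a walk of exactly that length. *)
Lemma dist_potential x v : dist x v = f x v.
Proof.
have [wd min_d] := distP (potential_connect x v).
apply/eqP; rewrite eqn_leq min_d ?potential_walk //=.
by case/has_walkP: wd => p [pp lp <-]; apply: potential_le_walk.
Qed.

End Distance.

(** Exchanging the two sums turns a second copy of the half sum into the one over the reversed
    order, and the diagonal contributes zero. Doubled indices thus become full sums, free of
    [enum_rank], which split along the vertex types. *)
Lemma sum_enum_rank_lt (T : finType) (F : T -> T -> nat) :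
    (forall x y, F x y = F y x) -> (forall x, F x x = 0) ->
  2 * (\sum_(x : T) \sum_(y : T | enum_rank x < enum_rank y) F x y)
    = \sum_(x : T) \sum_(y : T) F x y.
Proof.
move=> Fsym Frefl; rewrite mul2n -addnn.
rewrite [X in _ + X](exchange_big_dep predT) //= -big_split /=.
apply: eq_bigr => x _.
rewrite [RHS](bigID (fun y => enum_rank x < enum_rank y)) /=; congr (_ + _).
under eq_bigr do rewrite Fsym.
rewrite [RHS](bigD1 x) ?ltnn //= Frefl; apply: eq_bigl => y.
by rewrite -leqNgt ltn_neqAle andbC -(inj_eq enum_rank_inj y).
Qed.

Lemma double_szeged (G : sgraph) :
  2 * szeged G
    = \sum_(a : G) \sum_(b : G) edge a b * (closer a b * closer b a).
Proof.
rewrite -sum_enum_rank_lt => [|x y|x]; last by rewrite edge_irrefl.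
  congr (2 * _); apply: eq_bigr => a _; rewrite big_mkcondr /=.
  by apply: eq_bigr => b _; case: edge; rewrite ?mul1n.
by rewrite edge_sym [closer x y * _]mulnC.
Qed.

Lemma closerE (G : sgraph) (a b : G) :
  closer a b = \sum_(c : G) (dist c a < dist c b).
Proof.
rewrite /closer -sum1_card big_mkcond; apply: eq_bigr => c _.
by rewrite inE; case: (_ < _).
Qed.

(** * The witness graph and its distances *)

Section Witness.
Variable k : nat.

Definition c4k_vertex : finType := (bool * bool + 'I_k)%type.

(* The 4-cycle is the square bool * bool; its vertices (a, false) are joined to
   all of 'I_k and form with it the clique of order k + 2. *)
Definition c4k_edge : rel c4k_vertex := fun x y =>
  match x, y with
  | inl (a, b), inl (c, d) => (a != c) (+) (b != d)
  | inl (_, b), inr _ | inr _, inl (_, b) => ~~ b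
  | inr i, inr j => i != j
  end.

Lemma c4k_edge_sym : symmetric c4k_edge.
Proof.
by case=> [[a b]|i] [[c d]|j] //=; rewrite ?[c == a]eq_sym ?[d == b]eq_sym // eq_sym.
Qed.

Lemma c4k_edge_irrefl : irreflexive c4k_edge.
Proof. by case=> [[[] []]|i] //=; rewrite eqxx. Qed.

Definition c4k : sgraph := SGraph c4k_edge_sym c4k_edge_irrefl.

Definition c4k_dist (x y : c4k) : nat :=
  match x, y with
  | inl (a, b), inl (c, d) => (a != c) + (b != d)
  | inl (_, b), inr _ | inr _, inl (_, b) => b.+1
  | inr i, inr j => i != j
  end.

Lemma c4k_dist_refl x : c4k_dist x x = 0.
Proof. by case: x => [[[] []]|i] //=; rewrite eqxx. Qed.

Lemma c4k_dist_sym x y : c4k_dist x y = c4k_dist y x.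
Proof.
by case: x y => [[[] []]|i] [[[] []]|j] //=; rewrite eq_sym.
Qed.

Lemma c4k_dist_lip x y v :
  edge x y -> c4k_dist x v <= (c4k_dist y v).+1.
Proof.
by case: x y v => [[[] []]|i] [[[] []]|j] [[[] []]|l] //= _;
  exact: leq_trans (leq_b1 _) _.
Qed.

(** The next vertex of a geodesic: inside the square, correct the first coordinate and then the
    second; between square and clique, pass through the base vertex in the same column. *)
Lemma c4k_dist_desc x v :
  x != v -> exists2 y, edge x y & c4k_dist x v = (c4k_dist y v).+1.
Proof.
case: x v => [[a b]|i] [[c d]|j].
- case: (eqVneq a c) => [-> | ne_ac].
    case: (eqVneq b d) => [-> | ne_bd _]; first by rewrite eqxx.
    by exists (inl (c, d) : c4k); rewrite /= ?eqxx ?ne_bd.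
  by exists (inl (c, b) : c4k); rewrite /= ?eqxx ?ne_ac.
- case: b => _; last by exists (inr j : c4k); rewrite /= ?eqxx.
  by exists (inl (a, false) : c4k); rewrite /= ?eqxx.
- case: d => _; exists (inl (c, false) : c4k); by rewrite /= ?eqxx.
- by move=> ne_ij; exists (inr j : c4k); rewrite /= ?eqxx ?[i == j](negbTE ne_ij) //.
Qed.

Lemma c4kE (x y : c4k) : dist x y = c4k_dist x y.
Proof.
exact: dist_potential c4k_dist_refl c4k_dist_lip c4k_dist_desc x y.
Qed.

Lemma c4k_connect (x y : c4k) : connect (@edge c4k) x y.
Proof.
exact: potential_connect c4k_dist_refl c4k_dist_desc x y.
Qed.

Lemma card_c4k : #|c4k| = k + 4.
Proof. by rewrite card_sum card_prod card_bool card_ord addnC. Qed.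

Lemma sum_c4k (F : c4k -> nat) :
  \sum_x F x = F (inl (true, true)) + F (inl (true, false))
    + F (inl (false, true)) + F (inl (false, false)) + \sum_(i < k) F (inr i).
Proof.
rewrite big_sumType /=; congr (_ + _).
rewrite (eq_bigr (fun p => F (inl (p.1, p.2)))) => [|[]//].
rewrite -(pair_bigA _ (fun a b => F (inl (a, b)))) big_bool /= !big_bool.
by rewrite !addnA.
Qed.

(** * Counting the vertices closer to one end of an edge *)

Lemma sum_eq_ord (j : 'I_k) : \sum_(i < k) (i == j) = 1.
Proof.
by rewrite (bigD1 j) //= eqxx big1 // => i /negbTE->.
Qed.

Lemma sum_neq_ord (j : 'I_k) : \sum_(i < k) (j != i) = k.-1.
Proof.
rewrite (bigD1 j) //= eqxx add0n (eq_bigr (fun=> 1)) => [|i]; last first.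
  by rewrite eq_sym => ->.
by rewrite sum1_card (cardC1 j) card_ord.
Qed.

(** Any edge splits the square two against two. The vertices of ['I_k] lie at distance [b.+1] from
    [(a, b)], so they all side with the base end of a vertical edge and are equidistant from the
    ends of a horizontal one. *)
Lemma closer_cycle_cycle a b c d :
    edge (inl (a, b) : c4k) (inl (c, d)) ->
  closer (inl (a, b) : c4k) (inl (c, d)) = 2 + (b < d) * k.
Proof.
move=> e_xy; rewrite closerE sum_c4k !c4kE.
under eq_bigr do rewrite !c4kE.
by case: a b c d e_xy => [] [] [] [] //= _; rewrite sum_nat_const card_ord; lia.
Qed.

(** The two vertices counted are [(a, false)] and the vertex [(a, true)] above it. *)
Lemma closer_cycle_clique a (j : 'I_k) :
  closer (inl (a, false) : c4k) (inr j) = 2.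
Proof.
rewrite closerE sum_c4k !c4kE big1 => [|i _]; first by case: a.
by rewrite !c4kE /=; case: (i == j).
Qed.

Lemma closer_clique_cycle a (j : 'I_k) :
  closer (inr j : c4k) (inl (a, false)) = 1.
Proof.
rewrite closerE sum_c4k !c4kE.
rewrite (eq_bigr (fun i => (i == j) : nat)) => [|i _].
  by rewrite sum_eq_ord; case: a.
by rewrite !c4kE /=; case: (i == j).
Qed.

Lemma closer_clique_clique (i j : 'I_k) :
  i != j -> closer (inr i : c4k) (inr j) = 1.
Proof.
move=> ne_ij; rewrite closerE sum_c4k !c4kE /=.
rewrite (eq_bigr (fun l => (l == i) : nat)) => [|l _]; first by rewrite sum_eq_ord.
rewrite !c4kE /=; have [->|] := eqVneq l i; first by rewrite ne_ij.
by case: (l == j).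
Qed.

(** * The two indices, by row sums *)

Lemma wiener_c4k : 2 * wiener c4k = 16 + 12 * k + k * k.-1.
Proof.
rewrite /wiener sum_enum_rank_lt => [|x y|x]; last 2 first.
- by rewrite !c4kE c4k_dist_sym.
- by rewrite c4kE c4k_dist_refl.
have clique_row i : \sum_(y : c4k) dist (inr i : c4k) y = 6 + k.-1.
  rewrite sum_c4k !c4kE; under eq_bigr do rewrite c4kE /=.
  by rewrite sum_neq_ord.
have cycle_row a b : \sum_(y : c4k) dist (inl (a, b) : c4k) y = 4 + b.+1 * k.
  rewrite sum_c4k !c4kE; under eq_bigr do rewrite c4kE /=.
  by rewrite sum_nat_const card_ord; case: a; case: b => /=; lia.
rewrite sum_c4k !cycle_row; under eq_bigr do rewrite clique_row.
by rewrite sum_nat_const card_ord /=; lia.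
Qed.

Lemma szeged_c4k : 2 * szeged c4k = 32 + 16 * k + k * k.-1.
Proof.
rewrite double_szeged.
have cc a b c d : edge (inl (a, b) : c4k) (inl (c, d)) *
    (closer (inl (a, b) : c4k) (inl (c, d)) * closer (inl (c, d) : c4k) (inl (a, b)))
  = ((a != c) (+) (b != d)) * ((2 + (b < d) * k) * (2 + (d < b) * k)).
  (* The [closer] formula holds on edges only; elsewhere both sides vanish through the adjacency
     factor. *)
  rewrite -[(_ != _) (+) _]/(edge (inl (a, b) : c4k) (inl (c, d))).
  case e_xy: (edge _ _) => //.
  by rewrite !closer_cycle_cycle // edge_sym.
have ck a b i : edge (inl (a, b) : c4k) (inr i) *
    (closer (inl (a, b) : c4k) (inr i) * closer (inr i : c4k) (inl (a, b)))
  = (~~ b) * 2.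
  by case: b; rewrite //= closer_cycle_clique closer_clique_cycle.
have kc i a b : edge (inr i : c4k) (inl (a, b)) *
    (closer (inr i : c4k) (inl (a, b)) * closer (inl (a, b) : c4k) (inr i))
  = (~~ b) * 2.
  by rewrite edge_sym [closer _ _ * _]mulnC ck.
have kk (i j : 'I_k) : edge (inr i : c4k) (inr j) *
    (closer (inr i : c4k) (inr j) * closer (inr j : c4k) (inr i)) = (i != j).
  have [-> | ne_ij] := eqVneq i j; first by rewrite /= eqxx.
  by rewrite /= ne_ij !closer_clique_clique // eq_sym.
have clique_row (i : 'I_k) : \sum_(y : c4k) edge (inr i : c4k) y *
    (closer (inr i : c4k) y * closer y (inr i : c4k)) = 4 + k.-1.
  rewrite sum_c4k !kc; under eq_bigr do rewrite kk.
  by rewrite sum_neq_ord.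
(* The vertical edge contributes [2 * (2 + k)], the horizontal one [4], and at a base vertex each of
   the [k] edges to the clique contributes [2]. *)
have cycle_row a b : \sum_(y : c4k) edge (inl (a, b) : c4k) y *
    (closer (inl (a, b) : c4k) y * closer y (inl (a, b) : c4k))
  = (~~ b) * (2 * k) + (2 * (2 + k) + 4).
  rewrite sum_c4k !cc; under eq_bigr do rewrite ck.
  by rewrite sum_nat_const card_ord; case: a; case: b => /=; lia.
rewrite sum_c4k !cycle_row; under eq_bigr do rewrite clique_row.
by rewrite sum_nat_const card_ord /=; lia.
Qed.

Lemma gap_c4k : gap c4k = Posz (2 * (k + 4)).
Proof.
by rewrite /gap; move: wiener_c4k szeged_c4k; lia.
Qed.

End Witness.

(** * Connectedness after deleting a vertex *)

Lemma c4k_del_connected k (v : c4k k) : 1 < k -> connected (del_vertex v).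
Proof.
move=> k_gt1.
(* A surviving vertex of ['I_k] serves as hub: every other remaining vertex is linked to it. *)
have [h v_h]: exists h : 'I_k, inr h != v :> c4k k.
  pose i0 := Ordinal (ltnW k_gt1); pose i1 := Ordinal k_gt1.
  have [eq_v | ne_v] := eqVneq (inr i0 : c4k k) v; last by exists i0.
  by exists i1; rewrite -eq_v.
pose z : del_vertex v := Sub (inr h) v_h.
have csym : connect_sym (@edge (del_vertex v)).
  exact/sym_connect_sym/edge_sym.
have square_base a (v_x : inl (a, false) != v :> c4k k) :
    connect (@edge (del_vertex v)) (Sub (inl (a, false)) v_x) z.
  exact: connect1.
suff z_connect x : connect (@edge (del_vertex v)) x z.
  split; first by apply/card_gt0P; exists z.
  by move=> x y; apply: connect_trans (z_connect x) _; rewrite csym.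
case: x => [[[a b]|i] v_x].
  case: b v_x => v_x; last exact: square_base.
  have [eq_v | v_y] := eqVneq (inl (a, false) : c4k k) v; last first.
    apply: connect_trans (square_base a v_y); apply: connect1.
    by rewrite /= /del_edge /= eqxx.
  (* The base vertex below [(a, true)] is the deleted one, so the route crosses the top of the
     square and descends the other column. *)
  have v_y : inl (~~ a, true) != v :> c4k k by rewrite -eq_v; case: (a).
  have v_w : inl (~~ a, false) != v :> c4k k by rewrite -eq_v; case: (a).
  apply: connect_trans (square_base _ v_w).
  apply: (@connect_trans _ _ (Sub (inl (~~ a, true)) v_y)); apply: connect1;
    by rewrite /= /del_edge /=; case: (a).
have [eq_ih | ne_ih] := eqVneq i h; last exact: connect1.
by rewrite (_ : exist _ _ _ = z) //; apply: val_inj; rewrite /= eq_ih.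
Qed.

(** * An isomorphism invariant excluding the exceptional graphs *)

Definition disjoint_nonedges (G : sgraph) :=
  exists w : G * G * (G * G), [/\ uniq [:: w.1.1; w.1.2; w.2.1; w.2.2],
    ~~ edge w.1.1 w.1.2 & ~~ edge w.2.1 w.2.2].

Lemma disjoint_nonedges_iso (G H : sgraph) :
  graph_iso G H -> disjoint_nonedges G -> disjoint_nonedges H.
Proof.
case=> f /bij_inj f_inj f_edge [[[x y] [z t]] /= [Uw nxy nzt]].
exists ((f x, f y), (f z, f t)); rewrite /= !f_edge; split=> //.
by have := map_inj_uniq f_inj [:: x; y; z; t]; rewrite /= Uw.
Qed.

Lemma complete_no_disjoint_nonedges n : ~ disjoint_nonedges (complete_graph n).
Proof.
by case=> -[[x y] [z t]] /= [+ /negPn/eqP eq_xy _]; rewrite eq_xy !inE eqxx.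
Qed.

Lemma Knt_no_disjoint_nonedges n t : ~ disjoint_nonedges (Knt n t).
Proof.
case=> -[[x y] [z w]] /= [].
(* Either [None] occurs twice among the four vertices, or one pair avoids it; that pair, being
   non-adjacent, consists of equal vertices. Both contradict distinctness. *)
case: x y z w => [x|] [y|] [z|] [w|] //=; rewrite ?inE ?eqxx ?orbT ?andbF //=;
  move=> U /negPn/eqP eq1; do ?move=> /negPn/eqP eq2; subst;
  by rewrite ?inE ?eqxx ?orbT ?andbF in U.
Qed.

Lemma unexceptional_of_disjoint_nonedges n (G : sgraph) :
  disjoint_nonedges G -> ~ exceptional n G.
Proof.
move=> dG [] /disjoint_nonedges_iso/(_ dG).
- exact: complete_no_disjoint_nonedges.
- exact: Knt_no_disjoint_nonedges.
- exact: Knt_no_disjoint_nonedges.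
Qed.

Theorem lemma8 (n : nat) (hn : 10 <= n) :
  exists G : sgraph,
    [/\ #|G| = n, two_connected G, ~ exceptional n G
      & gap G = Posz (2 * n)].
Proof.
have [k -> k_gt1]: exists2 k, n = k + 4 & 1 < k by exists (n - 4); lia.
exists (c4k k); split.
- exact: card_c4k.
- split; first by rewrite card_c4k; lia.
    by split; [rewrite card_c4k; lia | exact: c4k_connect].
  by move=> v; apply: c4k_del_connected.
- apply: unexceptional_of_disjoint_nonedges.
  by exists ((inl (true, true), inl (false, false)),
             (inl (true, false), inl (false, true))).
- exact: gap_c4k.
Qed.
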